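(* Let $\lambda\ge 0$, let $\hat{\pi}:\mathcal{X}\to\mathcal{B}$ be any policy, and let $\pi^\star_\lambda$ be the oracle policy at dual variable $\lambda$. For $x\in\mathcal{X}$ let $$M_\lambda(x):=\max_{b\in\mathcal{B}}\big[f_\lambda(x,\pi^\star_\lambda(x))-f_\lambda(x,b)\big],\qquad \bar{M}:=\sup_{x}M_\lambda(x).$$ Then $$\mathrm{Reg}_\lambda(\hat{\pi})\;\le\;\mathbb{E}_{x\sim\mathcal{D}}\Big[M_\lambda(x)\cdot\mathbf{1}\{\hat{\pi}(x)\ne\pi^\star_\lambda(x)\}\Big]\;\le\;\bar{M}\cdot\mathbb{P}_{x\sim\mathcal{D}}\big(\hat{\pi}(x)\ne\pi^\star_\lambda(x)\big).$$
   Context: $\mathcal{X}$ is a measurable input space with probability distribution $\mathcal{D}$; $\mathcal{B}=\{b_1,\dots,b_K\}$ is a finite set of budgets with real costs $\mathrm{C}(b_1)\le\cdots\le \mathrm{C}(b_K)$; $\mathrm{Acc}:\mathcal{X}\times\mathcal{B}\to[0,1]$, with $x\mapsto\mathrm{Acc}(x,b)$ measurable for each $b$. A policy is a measurable map $\pi:\mathcal{X}\to\mathcal{B}$. For $\lambda\ge 0$: - $f_\lambda(x,b):=\mathrm{Acc}(x,b)-\lambda\,\mathrm{C}(b)$. - The oracle policy $\pi^\star_\lambda$ is the policy with $\pi^\star_\lambda(x)\in\operatorname{arg\,max}_{b\in\mathcal{B}}f_\lambda(x,b)$ for every $x$ (with any fixed measurable tie-breaking). - The penalized value of a policy is $J_\lambda(\pi):=\mathbb{E}_{x\sim\mathcal{D}}[\mathrm{Acc}(x,\pi(x))-\lambda\,\mathrm{C}(\pi(x))]$.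 - The relaxed regret is $\mathrm{Reg}_\lambda(\hat{\pi}):=J_\lambda(\pi^\star_\lambda)-J_\lambda(\hat{\pi})$. *)

(* Defs.v *)
From HB Require Import structures.
From mathcomp Require Import all_boot all_order all_algebra.
From mathcomp Require Import all_classical all_reals all_analysis.
Set Implicit Arguments.
Unset Strict Implicit.
Unset Printing Implicit Defensive.
Import Order.TTheory GRing.Theory Num.Theory.
Local Open Scope classical_set_scope.
Local Open Scope ring_scope.

(* The nonempty finite set {b_1, ..., b_(k+1)}; b_(i+1) is the ordinal i.
   It carries the discrete sigma-algebra, so that a policy is an element of
   {mfun X >-> budget k}. *)
Definition budget (k : nat) : Type := 'I_k.+1.

HB.instance Definition _ (k : nat) := Finite.on (budget k).
HB.instance Definition _ (k : nat) := isPointed.Build (budget k) (ord0 : 'I_k.+1).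
HB.instance Definition _ (k : nat) :=
  @isMeasurable.Build default_measure_display (budget k)
    (@discrete_measurable (budget k)) (@discrete_measurable0 (budget k))
    (@discrete_measurableC (budget k)) (@discrete_measurableU (budget k)).

(* The value at ord0 is itself one of the values, so this is the maximum of F
   even when F is negative. *)
Definition budget_max (R : realType) (k : nat) (F : budget k -> R) : R :=
  \big[Num.max/F (ord0 : 'I_k.+1)]_(b : budget k) F b.

Definition argmax (R : realType) (k : nat) (F : budget k -> R) :
    set (budget k) :=
  [set b | forall b', F b' <= F b].

Section penalized_value.
Context (R : realType) (d : measure_display) (X : measurableType d) (k : nat).
Variables (Acc : X -> budget k -> R) (C : budget k -> R) (lambda : R).

Definition pen_acc (x : X) (b : budget k) : R := Acc x b - lambda * C b.

Definition oracle (p : {mfun X >-> budget k}) : Prop :=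
  forall x, argmax (pen_acc x) (p x).

Definition pen_value (D : probability X R) (p : {mfun X >-> budget k}) :
    \bar R :=
  ('E_D[fun x => (Acc x (p x) - lambda * C (p x))%R])%E.

Definition regret (D : probability X R) (pstar phat : {mfun X >-> budget k}) :
    \bar R :=
  (pen_value D pstar - pen_value D phat)%E.

Definition max_gap (pstar : {mfun X >-> budget k}) (x : X) : R :=
  budget_max (fun b => pen_acc x (pstar x) - pen_acc x b).

(* When Acc takes values in [0, 1], max_gap pstar is bounded and X is nonempty,
   so that the real-valued sup is the genuine supremum. *)
Definition sup_gap (pstar : {mfun X >-> budget k}) : R :=
  sup (range (max_gap pstar)).

End penalized_value.

Definition disagree (d : measure_display) (X : measurableType d) (k : nat)
    (p q : {mfun X >-> budget k}) : set X :=
  [set x | p x <> q x].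

(* Main.v *)
Require Import Defs.
From HB Require Import structures.
From mathcomp Require Import all_boot all_order all_algebra.
From mathcomp Require Import all_classical all_reals all_analysis.
From mathcomp Require Import measurable_realfun.
Import Order.TTheory GRing.Theory Num.Theory.
Local Open Scope classical_set_scope.
Local Open Scope ring_scope.

(** By linearity, the regret is the expectation of the pointwise loss
    [f x (pstar x) - f x (phat x)]. This loss vanishes where the policies agree and is at most
    [gap x] elsewhere, which gives the first bound; replacing [gap x] by its supremum gives the
    second. What remains is to justify the integrals: finiteness of the budget set yields
    measurability ([measurable_fun_select], [measurable_budget_max], [measurable_disagree]) and,
    with [Acc] in [0,1], uniform bounds, hence integrability ([bounded_integrable]). *)

(** Splitting according to the value of [p] writes the function as a finite sum of products of a
    measurable section with the indicator of a fibre of [p]. *)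
Lemma measurable_fun_select {R : realType} {d : measure_display}
    {X : measurableType d} {k : nat} (f : X -> budget k -> R)
    (p : {mfun X >-> budget k}) :
  (forall b, measurable_fun setT (f ^~ b)) ->
  measurable_fun setT (fun x => f x (p x)).
Proof.
move=> mf.
have -> : (fun x => f x (p x)) =
    (fun x => \sum_(b : budget k) f x b * \1_(p @^-1` [set b]) x).
  apply/funext => x; rewrite (bigD1 (p x)) //= indicE mem_set // mulr1.
  rewrite big1 ?addr0 // => b bpx; rewrite indicE memNset ?mulr0 //=.
  by move=> pxb; rewrite pxb eqxx in bpx.
apply: measurable_sum => b; apply: measurable_funM => //.
exact/measurable_indic/measurable_funPTI.
Qed.

Lemma le_budget_max {R : realType} {k : nat} (F : budget k -> R) b :
  F b <= budget_max F.
Proof. exact: le_bigmax. Qed.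

Lemma budget_max_le {R : realType} {k : nat} (F : budget k -> R) (M : R) :
  (forall b, F b <= M) -> budget_max F <= M.
Proof. by move=> FM; apply: bigmax_le. Qed.

Lemma measurable_budget_max {R : realType} {d : measure_display}
    {X : measurableType d} {k : nat} (f : X -> budget k -> R) :
  (forall b, measurable_fun setT (f ^~ b)) ->
  measurable_fun setT (fun x => budget_max (f x)).
Proof.
(* Induction on the list of budgets with the default value kept fixed: the empty list leaves the
   section at [ord0]. *)
move=> mf; rewrite /budget_max; elim: (index_enum _) => [|b s ih].
  by apply: eq_measurable_fun (mf ord0) => x _; rewrite big_nil.
apply: eq_measurable_fun (measurable_maxr (mf b) ih) => x _.
by rewrite big_cons.
Qed.

(** Sorting the points by the value [b] of [p] gives a finite union of intersections of
    preimages. *)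
Lemma measurable_disagree {d : measure_display} {X : measurableType d}
    {k : nat} (p q : {mfun X >-> budget k}) :
  measurable (disagree p q).
Proof.
have -> : disagree p q =
    \bigcup_(b in [set: budget k]) (p @^-1` [set b] `&` q @^-1` (~` [set b])).
  apply/seteqP; split => x /=.
    by move=> pq; exists (p x) => //; split => //= /esym.
  by case=> b _ [pxb qxb] /esym; rewrite pxb.
apply: fin_bigcup_measurable => // b _.
by apply: measurableI; exact: measurable_funPTI.
Qed.

Lemma bounded_integrable {R : realType} {d : measure_display}
    {X : measurableType d} (D : probability X R) (f : X -> R) (M : R) :
  measurable_fun setT f -> (forall x, `|f x| <= M) ->
  D.-integrable setT (EFin \o f).
Proof.
move=> mf fM; apply: measurable_bounded_integrable => //.
  exact: le_lt_trans (probability_le1 D measurableT) (ltry 1).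
by exists M; split; [exact: num_real|move=> y /ltW My x _; exact: le_trans (fM x) My].
Qed.

Theorem theorem2 (R : realType) (d : measure_display) (X : measurableType d)
    (D : probability X R) (k : nat)
    (C : budget k -> R)
    (C_sorted : forall i j : 'I_k.+1, (i <= j)%N -> C i <= C j)
    (Acc : X -> budget k -> R)
    (Acc_meas : forall b, measurable_fun setT (fun x => Acc x b))
    (Acc_01 : forall x b, 0 <= Acc x b <= 1)
    (lambda : R) (lambda_ge0 : 0 <= lambda)
    (phat pstar : {mfun X >-> budget k})
    (pstar_oracle : oracle Acc C lambda pstar) :
  (regret Acc C lambda D pstar phat
     <= 'E_D[fun x => (max_gap Acc C lambda pstar x
                        * \1_(disagree phat pstar) x)%R]
     <= (sup_gap Acc C lambda pstar)%:E * D (disagree phat pstar))%E.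
Proof.
set f := pen_acc Acc C lambda; set A := disagree phat pstar.
set gap := max_gap Acc C lambda pstar.
have mA : measurable A by exact: measurable_disagree.
have m1A : measurable_fun setT (\1_A : X -> R) by exact: measurable_indic.
have mf b : measurable_fun setT (f ^~ b) by exact: measurable_funB.
have mfp (p : {mfun X >-> budget k}) : measurable_fun setT (fun x => f x (p x)).
  exact: measurable_fun_select.
(* A bound on [f] uniform in [x]: 1 accounts for the accuracy, the maximum for the penalty. *)
pose B := 1 + budget_max (fun b => `|lambda * C b|).
have fB x b : `|f x b| <= B.
  apply: le_trans (ler_normB _ _) _; apply: lerD.
    by have /andP[a0 a1] := Acc_01 x b; rewrite ger0_norm.
  exact: (le_budget_max (fun b => `|lambda * C b|)).
have mgap : measurable_fun setT gap.
  by apply: measurable_budget_max => b; apply: measurable_funB.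
have gap_ge x b : f x (pstar x) - f x b <= gap x.
  exact: (le_budget_max (fun b => f x (pstar x) - f x b)).
(* The budget [pstar x] itself contributes the difference 0 to the maximum. *)
have gap_ge0 x : 0 <= gap x by apply: le_trans (gap_ge x (pstar x)); rewrite subrr.
have gapB x : gap x <= B + B.
  apply: budget_max_le => b; apply: le_trans (ler_norm _) _.
  by apply: le_trans (ler_normB _ _) _; apply: lerD.
(* The real [sup] dominates its set only if that set is bounded above, here by [B + B]. *)
have gap_sup x : gap x <= sup_gap Acc C lambda pstar.
  by apply: ub_le_sup; [exists (B + B) => _ [y _ <-]|exists x].
have ifp (p : {mfun X >-> budget k}) :
    D.-integrable setT (EFin \o (fun x => f x (p x))).
  exact: (@bounded_integrable _ _ _ _ _ B).
have iA : D.-integrable setT (EFin \o (fun x => gap x * \1_A x)).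
  apply: (@bounded_integrable _ _ _ _ _ (B + B)).
    exact: measurable_funM.
  move=> x; rewrite ger0_norm ?mulr_ge0 // indicE.
  by case: (x \in A); rewrite ?mulr1 ?mulr0 //; exact: le_trans (gapB x).
apply/andP; split.
  (* Integrability of both terms turns the difference of expectations into a single integral, so a
     pointwise comparison suffices. *)
  rewrite /regret /pen_value unlock -integralB_EFin //; [|exact: ifp..].
  apply: le_integral => //.
    by apply: integrableB => //; exact: ifp.
  move=> x _; rewrite -EFinB lee_fin indicE -/(f x _).
  have [->|/eqP pq] := eqVneq (phat x) (pstar x).
    by rewrite subrr mulr_ge0.
  by rewrite mem_set // mulr1; exact: gap_ge.
have i1A : D.-integrable setT (EFin \o (\1_A : X -> R)).
  by apply: (@bounded_integrable _ _ _ _ _ 1) => // x;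
    rewrite indicE normr_nat lern1 leq_b1.
(* The probability of [A] is the expectation of its indicator; moving the constant inside makes this
   bound pointwise as well. *)
rewrite unlock -(expectation_indic D mA) unlock -integralZl //.
apply: le_integral => //.
  exact: integrableZl.
by move=> x _; rewrite -EFinM lee_fin ler_wpM2r.
Qed.
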